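(* Let $x_0\in\mathbb{R}^{N_x}$. If the local communication constraint set $\mathcal{L}$ is chosen such that $\mathcal{Y}(x_0)=\mathcal{Y}_{\mathcal{L}}(x_0)$, then the localized MPC problem attains optimal global performance for the state $x_0$, i.e. $f^*=f^*_{\mathcal{L}}$.
   Context: Fix integers $N_x,N_u,T\ge 1$ and real matrices $A\in\mathbb{R}^{N_x\times N_x}$, $B\in\mathbb{R}^{N_x\times N_u}$, defining the system $x(t+1)=Ax(t)+Bu(t)$. Put $N_\Phi:=N_x(T+1)+N_uT$. Matrix $Z_{AB}$: $Z_{AB}:=\begin{bmatrix} I-Z\hat A & -Z\hat B\end{bmatrix}\in\mathbb{R}^{N_x(T+1)\times N_\Phi}$, where $Z$ is the block-downshift matrix (identity blocks $I_{N_x}$ on the first block sub-diagonal, zeros elsewhere), $\hat A=\operatorname{blkdiag}(A,\dots,A)$, $\hat B=\operatorname{blkdiag}(B,\dots,B)$ with compatible dimensions. Explicitly, applied to a vector $(x_0,\dots,x_T,u_0,\dots,u_{T-1})$ with $x_t\in\mathbb{R}^{N_x}$, $u_t\in\mathbb{R}^{N_u}$, $Z_{AB}$ gives the vector whose block $0$ is $x_0$ and whose block $t$ is $x_t-Ax_{t-1}-Bu_{t-1}$ for $t=1,\dots,T$. The matrix $\begin{bmatrix} I\\0\end{bmatrix}\in\mathbb{R}^{N_x(T+1)\times N_x}$ has top block $I_{N_x}$ and zeros below. Decision variable: $\Phi=\begin{bmatrix}\Phi_x\\ \Phi_u\end{bmatrix}\in\mathbb{R}^{N_\Phi\times N_x}$,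 where $\Phi_x$ has $N_x(T+1)$ rows and $\Phi_u$ has $N_uT$ rows. $(\Phi)_{N_x+1:,:}$ denotes $\Phi$ with its first $N_x$ rows removed. Locality constraint: $\mathcal{L}\subseteq\mathbb{R}^{N_\Phi\times N_x}$ is the set of all matrices with a prescribed sparsity pattern, i.e. there is a fixed set $S$ of positions $(i,j)$ such that $\Phi\in\mathcal{L}$ iff $(\Phi)_{i,j}=0$ for every $(i,j)\notin S$. Trajectory sets: $\mathcal{Y}(x_0):=\{\mathbf{y}:\exists\,\Phi\text{ s.t. }Z_{AB}\Phi=\begin{bmatrix} I\\0\end{bmatrix},\ \mathbf{y}=(\Phi)_{N_x+1:,:}x_0\}$ and $\mathcal{Y}_{\mathcal{L}}(x_0):=\{\mathbf{y}:\exists\,\Phi\text{ s.t. }Z_{AB}\Phi=\begin{bmatrix} I\\0\end{bmatrix},\ \Phi\in\mathcal{L},\ \mathbf{y}=(\Phi)_{N_x+1:,:}x_0\}$. MPC problems: let $f(\mathbf{x},\mathbf{u})=\sum_{t=0}^{T-1}f_t(x_t,u_t)+f_T(x_T)$, where the $f_t$ and $f_T$ are closed, proper, convex functions with minimum at the origin, and let $\mathcal{X}=\mathcal{X}_0\times\dots\times\mathcal{X}_T$, $\mathcal{U}=\mathcal{U}_0\times\dots\times\mathcal{U}_{T-1}$ be products of closed convex sets containing the origin. The global MPC problem for state $x_0$ is: minimize $f(\Phi_xx_0,\Phi_ux_0)$ over $\Phi$ subject to $Z_{AB}\Phi=\begin{bmatrix} I\\0\end{bmatrix}$, $\Phi_xx_0\in\mathcal{X}$,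 $\Phi_ux_0\in\mathcal{U}$; its optimal value is $f^*$. The localized MPC problem is the same problem with the additional constraint $\Phi\in\mathcal{L}$; its optimal value is $f^*_{\mathcal{L}}$. ''Localized MPC attains optimal global performance'' for $x_0$ means $f^*=f^*_{\mathcal{L}}$ (here $f$ is an arbitrary objective of the form $\sum_{t=0}^{T-1}f_t(x_t,u_t)+f_T(x_T)$ with closed, proper, convex $f_t$, $f_T$ having their minimum at the origin, and $\mathcal{X},\mathcal{U}$ are arbitrary products of closed convex sets containing the origin). *)

(* Defs.v *)
From HB Require Import structures.
From mathcomp Require Import all_boot all_order all_algebra.
From mathcomp Require Import all_classical all_reals all_analysis.

Set Implicit Arguments.
Unset Strict Implicit.
Unset Printing Implicit Defensive.

Import Order.TTheory GRing.Theory Num.Theory.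
Import numFieldNormedType.Exports.

Local Open Scope classical_set_scope.
Local Open Scope ring_scope.

(* A stacked vector with k blocks of size n has size \sum_(i < k) n, the form
   expected by the block-matrix operations; it equals n * k propositionally.
   Rows of Phi: the blocks x_0, ..., x_T, followed by u_0, ..., u_{T-1}. *)
Notation NPhi Nx Nu T := (\sum_(t < T.+1) Nx + \sum_(t < T) Nu)%N.

Section SystemLevel.
Context {R : realType} {Nx Nu T : nat}.
Variables (A : 'M[R]_Nx) (B : 'M[R]_(Nx, Nu)).

Definition downshift : 'M[R]_(\sum_(i < T.+1) Nx, \sum_(j < T.+1) Nx) :=
  \mxblock_(i < T.+1, j < T.+1) (if i == j.+1 :> nat then 1%:M else 0 : 'M[R]_Nx).

Definition Ahat : 'M[R]_(\sum_(i < T.+1) Nx) := \mxdiag_(i < T.+1) A.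

(* T diagonal blocks B over a final zero block row, so that Z Bhat is
   well-dimensioned: there is an input u_t only for t < T. *)
Definition Bhat : 'M[R]_(\sum_(i < T.+1) Nx, \sum_(j < T) Nu) :=
  \mxblock_(i < T.+1, j < T) (if i == j :> nat then B else 0 : 'M[R]_(Nx, Nu)).

Definition ZAB : 'M[R]_(\sum_(i < T.+1) Nx, NPhi Nx Nu T) :=
  row_mx (1%:M - downshift *m Ahat) (- (downshift *m Bhat)).

Definition initial_block : 'M[R]_(\sum_(i < T.+1) Nx, Nx) :=
  \mxcol_(i < T.+1) (if i == 0 :> nat then 1%:M else 0 : 'M[R]_Nx).

Definition achievable : set 'M[R]_(NPhi Nx Nu T, Nx) :=
  [set Phi | ZAB *m Phi = initial_block].

End SystemLevel.

Fact drop_rows_subproof (k m : nat) (i : 'I_(m - k)) : (k + i < m)%N.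
Proof. by rewrite -ltn_subRL. Qed.

Definition drop_rows {R : Type} (k : nat) {m n : nat} (M : 'M[R]_(m, n)) :
    'M[R]_(m - k, n) :=
  rowsub (fun i : 'I_(m - k) => Ordinal (drop_rows_subproof i)) M.

Definition sparsity_set {R : realType} {m n : nat} (L : set 'M[R]_(m, n)) :=
  exists S : {set 'I_m * 'I_n}, forall Phi : 'M[R]_(m, n),
    L Phi <-> (forall i j, (i, j) \notin S -> Phi i j = 0).

Section Trajectories.
Context {R : realType} {Nx Nu T : nat}.
Variables (A : 'M[R]_Nx) (B : 'M[R]_(Nx, Nu)).
Variables (L : set 'M[R]_(NPhi Nx Nu T, Nx)) (x0 : 'cV[R]_Nx).

Definition traj : set 'cV[R]_(NPhi Nx Nu T - Nx) :=
  [set y | exists Phi : 'M[R]_(NPhi Nx Nu T, Nx),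
     achievable A B Phi /\ y = drop_rows Nx Phi *m x0].

Definition local_traj : set 'cV[R]_(NPhi Nx Nu T - Nx) :=
  [set y | exists Phi : 'M[R]_(NPhi Nx Nu T, Nx),
     [/\ achievable A B Phi, L Phi & y = drop_rows Nx Phi *m x0]].

End Trajectories.

Definition epigraph {R : realType} {V : Type} (g : V -> \bar R) :
    set (V * R^o) :=
  [set p | (g p.1 <= p.2%:E)%E].

Definition closed_fun {R : realType} {V : topologicalType} (g : V -> \bar R) :=
  closed (epigraph g).

Definition proper_fun {R : realType} {V : Type} (g : V -> \bar R) :=
  (forall v, g v != -oo%E) /\ (exists v, (g v < +oo)%E).

Definition convex_fun {R : realType} {V : lmodType R} (g : V -> \bar R) :=
  convex_set (epigraph g).

Definition min_at_origin {R : realType} {V : nmodType} (g : V -> \bar R) :=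
  forall v, (g 0%R <= g v)%E.

Section MPC.
Context {R : realType} {Nx Nu T : nat}.
Variables (A : 'M[R]_Nx) (B : 'M[R]_(Nx, Nu)).
Variables (f : 'I_T -> 'cV[R]_Nx * 'cV[R]_Nu -> \bar R).
Variables (fT : 'cV[R]_Nx -> \bar R).
Variables (X : 'I_T.+1 -> set 'cV[R]_Nx) (U : 'I_T -> set 'cV[R]_Nu).
Variables (L : set 'M[R]_(NPhi Nx Nu T, Nx)) (x0 : 'cV[R]_Nx).

Definition block_product {k n : nat} (C : 'I_k -> set 'cV[R]_n) :
    set 'cV[R]_(\sum_(i < k) n) :=
  [set v | forall i, C i (submxcol v i)].

(* Properness of the summands rules out -oo, so no indeterminate sum arises. *)
Definition objective (x : 'cV[R]_(\sum_(i < T.+1) Nx))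
    (u : 'cV[R]_(\sum_(i < T) Nu)) : \bar R :=
  (\sum_(t < T) f t (submxcol x (widen_ord (leqnSn T) t), submxcol u t)
   + fT (submxcol x ord_max))%E.

Definition feasible : set 'M[R]_(NPhi Nx Nu T, Nx) :=
  [set Phi | [/\ achievable A B Phi,
                 block_product X (usubmx Phi *m x0) &
                 block_product U (dsubmx Phi *m x0)]].

(* Infimum over the feasible set; +oo when it is empty. *)
Definition optimal_value (C : set 'M[R]_(NPhi Nx Nu T, Nx)) : \bar R :=
  ereal_inf [set objective (usubmx Phi *m x0) (dsubmx Phi *m x0) | Phi in C].

Definition global_value : \bar R := optimal_value feasible.

Definition localized_value : \bar R := optimal_value (feasible `&` L).

End MPC.

(* Main.v *)
(* The first block row of [ZAB *m Phi = initial_block] pins the first Nx rows of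
   every achievable Phi to the identity. Hence the rows removed by [drop_rows]
   already determine Phi *m x0, and with it feasibility and cost: equal
   trajectory sets give equal sets of attained costs. *)
Require Import Defs.
From HB Require Import structures.
From mathcomp Require Import all_boot all_order all_algebra.
From mathcomp Require Import all_classical all_reals all_analysis.

Import Order.TTheory GRing.Theory Num.Theory.
Import numFieldNormedType.Exports.

Local Open Scope classical_set_scope.
Local Open Scope ring_scope.

(** The identity blocks of [downshift] sit where [i = j + 1], which never happens in block row 0. *)
Lemma submxcol_downshift (R : realType) (Nx T n : nat)
    (M : 'M[R]_(\sum_(t < T.+1) Nx, n)) :
  submxcol (downshift *m M) ord0 = 0.
Proof.
by rewrite -submxcol_mul submxcol_matrix [X in X *m _]mxrow0 mul0mx.
Qed.

(** Both terms carrying [downshift] vanish in block 0, so only the identity part of [ZAB], acting on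
    [usubmx Phi], survives there. *)
Lemma achievable_head (R : realType) (Nx Nu T : nat) (A : 'M[R]_Nx)
    (B : 'M[R]_(Nx, Nu)) (Phi : 'M[R]_(NPhi Nx Nu T, Nx)) :
  achievable A B Phi -> submxcol (usubmx Phi) ord0 = 1%:M.
Proof.
rewrite /achievable /= -[in ZAB A B *m _](vsubmxK Phi) /ZAB mul_row_col.
rewrite mulmxBl mul1mx mulNmx -!mulmxA => /(congr1 (fun M => submxcol M ord0)).
by rewrite !submxcolB !submxcol_downshift !subr0 mxcolK.
Qed.

Lemma drop_rowsM (R : realType) (k m n p : nat) (M : 'M[R]_(m, n))
    (N : 'M[R]_(n, p)) :
  drop_rows k M *m N = drop_rows k (M *m N).
Proof. by rewrite /drop_rows mul_rowsub_mx. Qed.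

Lemma eq_head_drop_rows (R : realType) (Nx Nu T n : nat)
    (M N : 'M[R]_(NPhi Nx Nu T, n)) :
  submxcol (usubmx M) ord0 = submxcol (usubmx N) ord0 ->
  drop_rows Nx M = drop_rows Nx N -> M = N.
Proof.
move=> eq_head eq_tail; apply/matrixP => i j.
have [i_ge|i_lt] := leqP Nx i.
  have i_sub : (i - Nx < NPhi Nx Nu T - Nx)%N
    by rewrite ltn_sub2r // (leq_ltn_trans i_ge).
  have /matrixP/(_ (Ordinal i_sub) j) := eq_tail; rewrite !mxE.
  by congr (M _ j = N _ j); apply: val_inj => /=; rewrite subnKC.
have /matrixP/(_ (Ordinal i_lt) j) := eq_head; rewrite !mxE.
(* A row of block 0 keeps its index in the stacked matrix: its offset, the total size of the
   preceding blocks, is an empty sum. *)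
by congr (M _ j = N _ j); apply: val_inj;
  rewrite [LHS]tagnat.RankEsum big_pred0.
Qed.

(** [Phi] and [Psi] may differ as matrices; only their products with [x0] are compared, and the top
    block of both products is [x0]. *)
Lemma achievable_mul_inj (R : realType) (Nx Nu T : nat) (A : 'M[R]_Nx)
    (B : 'M[R]_(Nx, Nu)) (x0 : 'cV[R]_Nx)
    (Phi Psi : 'M[R]_(NPhi Nx Nu T, Nx)) :
  achievable A B Phi -> achievable A B Psi ->
  drop_rows Nx Phi *m x0 = drop_rows Nx Psi *m x0 -> Phi *m x0 = Psi *m x0.
Proof.
move=> /achievable_head Phi0 /achievable_head Psi0; rewrite !drop_rowsM.
apply: eq_head_drop_rows.
by rewrite -!mul_usub_mx -!submxcol_mul Phi0 Psi0.
Qed.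

Theorem proposition1 (R : realType) (Nx Nu T : nat)
    (Nx_gt0 : (0 < Nx)%N) (Nu_gt0 : (0 < Nu)%N) (T_gt0 : (0 < T)%N)
    (A : 'M[R]_Nx) (B : 'M[R]_(Nx, Nu))
    (L : set 'M[R]_(NPhi Nx Nu T, Nx)) (L_sparsity : sparsity_set L)
    (x0 : 'cV[R]_Nx)
    (trajE : traj A B x0 = local_traj A B L x0)
    (f : 'I_T -> 'cV[R]_Nx * 'cV[R]_Nu -> \bar R)
    (fP : forall t, [/\ closed_fun (f t), proper_fun (f t),
                        convex_fun (f t) & min_at_origin (f t)])
    (fT : 'cV[R]_Nx -> \bar R)
    (fTP : [/\ closed_fun fT, proper_fun fT,
               convex_fun fT & min_at_origin fT])
    (X : 'I_T.+1 -> set 'cV[R]_Nx)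
    (XP : forall t, [/\ closed (X t), convex_set (X t) & X t 0])
    (U : 'I_T -> set 'cV[R]_Nu)
    (UP : forall t, [/\ closed (U t), convex_set (U t) & U t 0]) :
  global_value A B f fT X U x0 = localized_value A B f fT X U L x0.
Proof.
(* Comparing the sets of costs rather than their infima also covers infeasible problems and infima
   that are not attained. The inclusion of localized costs in global ones holds because [L] only
   shrinks the feasible set. *)
congr ereal_inf; apply/seteqP; split => [_ [Phi [PhiA PhiX PhiU] <-]|];
  last by move=> _ [Phi [PhiF _] <-]; exists Phi.
have : traj A B x0 (drop_rows Nx Phi *m x0) by exists Phi.
(* [Psi] is a matrix in [L] realizing the trajectory of [Phi]; it replaces [Phi] at the same
   cost. *)
rewrite trajE => -[Psi [PsiA PsiL /(achievable_mul_inj _ _ _ _ _ _ _ _ _ PhiA PsiA) eqx0]].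
have equ : usubmx Psi *m x0 = usubmx Phi *m x0 by rewrite !mul_usub_mx eqx0.
have eqd : dsubmx Psi *m x0 = dsubmx Phi *m x0 by rewrite !mul_dsub_mx eqx0.
exists Psi; last by rewrite equ eqd.
by split=> //; split; rewrite ?equ ?eqd.
Qed.
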